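(* Let $\mathrm{ALG}$ be any non-preemptive deterministic online algorithm for ROLDARP and let $\beta<2$. Then there exists an instance of ROLDARP such that $\mathrm{OPT}' > \beta\cdot \mathrm{rev}(\mathrm{ALG})$, where $\mathrm{rev}(\mathrm{ALG})$ is the total revenue earned by $\mathrm{ALG}$ and $\mathrm{OPT}'$ is the maximum revenue that an offline schedule can earn from requests it completes within the first $T-2T/f$ time units. That is, no such algorithm can be better than $2$-competitive with respect to the revenue an optimal offline solution earns in the first $T-2T/f$ time units. This holds both for nonuniform revenues and when all requests are required to have the same revenue.
   Context: ROLDARP (Revenue Online Dial-a-Ride Problem). An instance consists of a complete undirected graph $G=(V,E)$ with a positive weight $w(u,v)$ on each edge (the time needed to travel between $u$ and $v$), a designated origin $o\in V$, a time limit $T>0$, a number $f$ with $1<f<T$ such that every edge weight is at most $T/f$, and a sequence of requests. Each request is a tuple $(s,d,t,p)$ with source $s$, destination $d$, release time $t\ge 0$ and revenue $p>0$. A single server of unit capacity is at $o$ at time $0$. To serve a request the server travels to $s$ and then from $s$ to $d$, starting the ride from $s$ no earlier than the release time; it carries at most one request at a time, and once it begins serving a request it must complete it (non-preemption). The revenue $p$ is earned if the request is completed by time $T$. An online algorithm learns of each request only at its release time. An offline schedule knows all requests in advance. *)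

(* Defs.v *)
From HB Require Import structures.
From mathcomp Require Import all_boot all_order all_algebra.
From mathcomp Require Import reals.

Set Implicit Arguments.
Unset Strict Implicit.
Unset Printing Implicit Defensive.

Import Order.TTheory GRing.Theory Num.Theory.

Local Open Scope ring_scope.

(* The part of an instance that is known from the start. The graph is simple
   and complete on [vertex]; the value 0 of [weight] on the diagonal is a
   convention (no edge is involved), and no triangle inequality is assumed. *)
Record network (R : realType) := Network {
  vertex :> finType;
  weight : vertex -> vertex -> R;
  origin : vertex;
  tlimit : R;
  fpar : R;
  _ : forall u, weight u u = 0;
  _ : forall u v, weight u v = weight v u;
  _ : forall u v, u != v -> 0 < weight u v <= tlimit / fpar;
  _ : 0 < tlimit;
  _ : 1 < fpar < tlimit
}.

Record request (R : realType) (N : network R) := Request {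
  source : N;
  destination : N;
  release : R;
  revenue : R
}.

(* Requests are listed by nondecreasing release time, so that the requests
   released up to a given time form a prefix and keep their indices when
   later requests are appended. *)
Definition request_sequence (R : realType) (N : network R)
    (rs : seq (request N)) : bool :=
  sorted (fun r r' => release r <= release r') rs &&
  all (fun r => (0 <= release r) && (0 < revenue r)) rs.

Definition uniform_revenue (R : realType) (N : network R)
    (rs : seq (request N)) : Prop :=
  exists p : R, all (fun r => revenue r == p) rs.

(* [Travel v]: move empty from the current vertex to [v].
   [Serve i]: ride from the source to the destination of the request of
   index [i]. *)
Inductive action (R : realType) (N : network R) :=
  | Travel of N
  | Serve of nat.
Arguments Travel {R N} v.
Arguments Serve {R N} i.

Record step (R : realType) (N : network R) := Step {
  depart : R;
  act : action N
}.

(* A schedule lists the successive steps of the server with their departure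
   times. A step, once started, runs to its end, and the server waits between
   the end of a step and the next departure. *)
Definition schedule (R : realType) (N : network R) := seq (step N).

(* The steps of [s] can be executed by a server that is free at vertex [x] at
   time [t]. *)
Fixpoint executable (R : realType) (N : network R) (rs : seq (request N))
    (x : N) (t : R) (s : schedule N) : Prop :=
  if s is st :: s' then
    t <= depart st /\
    match act st with
    | Travel v => executable rs v (depart st + weight x v) s'
    | Serve i =>
        if onth rs i is Some r then
          [/\ source r = x, release r <= depart st &
              executable rs (destination r)
                (depart st + weight x (destination r)) s']
        else False
    end
  else True.

Definition served (R : realType) (N : network R) (s : schedule N) : seq nat :=
  pmap (fun st => if act st is Serve i then Some i else None) s.

Definition feasible (R : realType) (N : network R) (rs : seq (request N))
    (s : schedule N) : Prop :=
  executable rs (origin N) 0 s /\ uniq (served s).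

Definition earned_by (R : realType) (N : network R) (rs : seq (request N))
    (D : R) (s : schedule N) : R :=
  \sum_(st <- s)
    if act st is Serve i then
      if onth rs i is Some r then
        if depart st + weight (source r) (destination r) <= D
        then revenue r else 0
      else 0
    else 0.

Definition is_max_revenue_by (R : realType) (N : network R)
    (rs : seq (request N)) (D : R) (x : R) : Prop :=
  (exists2 s, feasible rs s & earned_by rs D s = x) /\
  (forall s, feasible rs s -> earned_by rs D s <= x).

Definition problem (R : realType) :=
  forall N : network R, seq (request N) -> Prop.

Definition roldarp (R : realType) : problem R :=
  fun N rs => request_sequence rs.

Definition uniform_roldarp (R : realType) : problem R :=
  fun N rs => request_sequence rs /\ uniform_revenue rs.

Definition released_by (R : realType) (N : network R) (t : R)
    (rs : seq (request N)) : seq (request N) :=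
  [seq r <- rs | release r <= t].

Definition started_by (R : realType) (N : network R) (t : R)
    (s : schedule N) : schedule N :=
  [seq st <- s | depart st <= t].

(* A deterministic online algorithm is a map from instances to feasible
   schedules such that what is started up to time [t] is determined by the
   network and the requests released up to time [t]. *)
Definition online_algorithm (R : realType) (Pb : problem R)
    (alg : forall N : network R, seq (request N) -> schedule N) : Prop :=
  (forall N rs, Pb N rs -> feasible rs (alg N rs)) /\
  (forall N rs rs' t, Pb N rs -> Pb N rs' ->
     released_by t rs = released_by t rs' ->
     started_by t (alg N rs) = started_by t (alg N rs')).

(* Main.v *)
Require Import Defs.
From HB Require Import structures.
From mathcomp Require Import all_boot all_order all_algebra.
From mathcomp Require Import reals boolp zify lra.

Set Implicit Arguments.
Unset Strict Implicit.
Unset Printing Implicit Defensive.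

Import Order.TTheory GRing.Theory Num.Theory.

Local Open Scope ring_scope.

(* All distances are 2 and every request has equal source and destination, so
   serving takes no time and only travelling costs. The adversary keeps one
   request pending at every vertex: whenever the online server takes one, the
   next one is issued there at the beginning of a later step. Hence the online
   server earns at most one request per travel time. Offline, one visits in each
   step the vertex that the online server has just served for the last time, or
   else a vertex that it never serves. Such a visit yields everything the online
   server ever took there, plus one request that it never takes, so up to a
   bounded error the offline revenue is the number of steps plus the online
   revenue. *)

(** * Services of a schedule *)

Section Services.
Variables (R : realType) (N : network R).
Implicit Types (rs : seq (request N)) (s : schedule N) (x v : N) (t d : R).

(** Unlike [served], this keeps the departure times, on which both the revenue and the online
    condition depend. *)
Definition services s : seq (nat * R) :=
  pmap (fun st => if act st is Serve i then Some (i, depart st) else None) s.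

Lemma served_services s : served s = map fst (services s).
Proof. by elim: s => //= -[d [v|i]] s IHs //=; rewrite IHs. Qed.

Lemma services_started t s :
  services (started_by t s) = [seq p <- services s | p.2 <= t].
Proof.
by elim: s => //= -[d [v|i]] s IHs /=; case: ifP => _ //=; rewrite IHs.
Qed.

Lemma services_cat s1 s2 : services (s1 ++ s2) = services s1 ++ services s2.
Proof. by rewrite /services pmap_cat. Qed.

Lemma earned_by_services rs D s : earned_by rs D s =
  \sum_(p <- services s)
    if onth rs p.1 is Some r then
      if p.2 + weight (source r) (destination r) <= D then revenue r else 0
    else 0.
Proof.
rewrite /earned_by; elim: s => [|[d [v|i]] s IHs] /=; first by rewrite !big_nil.
  by rewrite big_cons /= add0r.
by rewrite !big_cons /= IHs.
Qed.

Lemma weight_id (u : N) : weight u u = 0.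
Proof. by case: (N) u. Qed.

Lemma earned_by_ge0 rs D s :
  all (fun r => 0 < revenue r) rs -> 0 <= earned_by rs D s.
Proof.
move=> rev0; rewrite earned_by_services sumr_ge0 // => p _.
case Dr: (onth rs p.1) => [r|//]; case: ifP => // _; apply: ltW.
have lt_p : (p.1 < size rs)%N by rewrite -onthTE Dr.
by move: (all_nthP r rev0 p.1 lt_p); rewrite -odflt_onth Dr.
Qed.

Lemma executable_mono rs x t t' s :
  t' <= t -> executable rs x t s -> executable rs x t' s.
Proof. by move=> le_t't; case: s => //= st s [le_t ?]; split=> //; lra. Qed.

Lemma services_released rs x t s i d :
  executable rs x t s -> (i, d) \in services s ->
  exists2 r, onth rs i = Some r & release r <= d.
Proof.
elim: s x t => //= -[e [v|j]] s IHs x t /= [_]; first exact: IHs.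
case Dr: (onth rs j) => [r|//] [_ le_re /IHs{}IHs].
by rewrite inE => /predU1P[[-> ->]|/IHs//]; exists r.
Qed.

Hypothesis triangle : forall u v w : N, weight u w <= weight u v + weight v w.

Lemma services_reach rs x t s i d r :
  executable rs x t s -> (i, d) \in services s -> onth rs i = Some r ->
  t + weight x (source r) <= d.
Proof.
move=> + + Dr; elim: s x t => //= -[e [v|j]] s IHs x t /= [le_te].
  by move=> /IHs{}IHs /IHs; have := triangle x v (source r); lra.
case Dr': (onth rs j) => [r'|//] [srcr' le_re /IHs{}IHs].
rewrite inE => /predU1P[[Dj ->]|/IHs].
  by move: Dr'; rewrite -Dj Dr => -[Dr']; rewrite Dr' srcr' weight_id; lra.
by have := triangle x (destination r') (source r); lra.
Qed.

(** Whichever service comes first, [services_reach] bounds the other from the end of its ride, and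
    the triangle inequality absorbs the ride. *)
Lemma services_gap rs x t s i d r j e r' :
  executable rs x t s -> (i, d) \in services s -> (j, e) \in services s ->
  i != j -> onth rs i = Some r -> onth rs j = Some r' ->
  d + weight (source r) (source r') <= e \/
  e + weight (source r') (source r) <= d.
Proof.
move=> + + + neq_ij Dr Dr'; elim: s x t => //= -[c [v|k]] s IHs x t /= [le_tc].
  exact: IHs.
case Dk: (onth rs k) => [q|//] [srcq le_qc exs].
rewrite !inE => /predU1P[[ik dc]|si] /predU1P[[jk ec]|sj].
- by rewrite ik jk eqxx in neq_ij.
- left; have := services_reach exs sj Dr'.
  move: Dk; rewrite -ik Dr => -[Dq]; rewrite -Dq in srcq *; rewrite -dc srcq.
  by have := triangle x (destination r) (source r'); lra.
- right; have := services_reach exs si Dr.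
  move: Dk; rewrite -jk Dr' => -[Dq]; rewrite -Dq in srcq *; rewrite -ec srcq.
  by have := triangle x (destination r') (source r); lra.
- exact: IHs exs si sj.
Qed.

End Services.

(** * Instantaneous services and existence of an optimum *)

Lemma executable_serve_all (R : realType) (N : network R)
    (rs : seq (request N)) (v : N) (t d : R) (l : seq nat) (s : schedule N) :
    t <= d ->
    (forall i, i \in l -> exists r,
       [/\ onth rs i = Some r, source r = v, destination r = v &
           release r <= d]) ->
    executable rs v d s ->
  executable rs v t ([seq Step d (Serve i) | i <- l] ++ s).
Proof.
move=> + + exs; elim: l t => /= [|i l IHl] t le_td hl.
  exact: executable_mono exs.
split=> //; have [r [-> -> -> le_rd]] := hl i (mem_head _ _).
split=> //; rewrite weight_id addr0; apply: IHl => // j lj.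
by apply: hl; rewrite inE lj orbT.
Qed.

(** With unit revenues the attainable values are natural numbers at most [size rs], so a greatest
    one exists; [s] shows that there is one at all. *)
Lemma max_revenue_exists (R : realType) (N : network R)
    (rs : seq (request N)) (D : R) (s : schedule N) :
    all (fun r => revenue r == 1) rs -> feasible rs s ->
  exists2 opt, is_max_revenue_by rs D opt & earned_by rs D s <= opt.
Proof.
move=> rev1 fs.
have natE s' : feasible rs s' ->
    exists2 m : nat, earned_by rs D s' = m%:R & (m <= size rs)%N.
  case=> exs' us'; pose P (p : nat * R) := if onth rs p.1 is Some r then
    p.2 + weight (source r) (destination r) <= D else false.
  exists (count P (services s')).
    rewrite earned_by_services -sum1_count natr_sum [RHS]big_mkcond /=.
    apply: eq_bigr => p _; rewrite /P; case Dr: (onth rs p.1) => [r|//].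
    case: ifP => // _; apply/eqP.
    have lt_p : (p.1 < size rs)%N by rewrite -onthTE Dr.
    by move: (all_nthP r rev1 p.1 lt_p); rewrite -odflt_onth Dr.
  apply: leq_trans (count_size _ _) _.
  rewrite -(size_map fst) -served_services -(size_iota 0 (size rs)).
  apply: uniq_leq_size => // i; rewrite served_services => /mapP[[j d] sj ->].
  have [r Dr _] := services_released exs' sj.
  by rewrite mem_iota /= -onthTE Dr.
pose Q m := `[< exists2 s', feasible rs s' & earned_by rs D s' = m%:R >].
have exQ : exists m, Q m.
  by have [m Dm _] := natE s fs; exists m; apply/asboolP; exists s.
have ubQ m : Q m -> (m <= size rs)%N.
  move=> /asboolP[s' /natE[m' -> le_m'] /eqP].
  by rewrite eqr_nat => /eqP <-.
case: (ex_maxnP exQ ubQ) => m /asboolP[s0 fs0 Es0] maxm.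
have ub s' : feasible rs s' -> earned_by rs D s' <= m%:R.
  move=> fs'; have [m' Em' _] := natE _ fs'; rewrite Em' ler_nat; apply: maxm.
  by apply/asboolP; exists s'.
by exists m%:R; [split=> //; exists s0 | exact: ub].
Qed.

Lemma map_uniq_inj_in (T U : eqType) (f : T -> U) (s : seq T) :
  uniq (map f s) -> {in s &, injective f}.
Proof.
elim: s => //= z s IHs /andP[zs us] x y; rewrite !inE.
case/predU1P=> [->|sx] /predU1P[->|sy] // eq_f; last exact: IHs eq_f.
  by rewrite eq_f map_f in zs.
by rewrite -eq_f map_f in zs.
Qed.

(** * Offline visits *)

Section Tour.
Variables (R : realType) (V : finType).

Definition tick (k : nat) : R := (2 * k)%:R.

Lemma tickS k : tick k.+1 = tick k + 2.
Proof. by rewrite /tick mulnS addnC natrD. Qed.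

Lemma le_tick k l : (tick k <= tick l) = (k <= l)%N.
Proof. by rewrite ler_nat leq_pmul2l. Qed.

(* [((v, m), d)] in [G] stands for: the request issued at [v] at time [tick m]
   is served at time [d]. *)
Implicit Types (G : seq (V * nat * R)) (ps : seq (V * nat)).
Implicit Types (g h : V * nat * R) (p : V * nat).

(** Windows are half-open and as long as the travel time 2, so services at distinct vertices never
    share one. Among nonnegative times, window 0 contains only time 0. *)
Definition in_window (k : nat) (d : R) := tick k - 2 < d <= tick k.

Definition visited G k v :=
  has (fun g => (g.1.1 == v) && in_window k g.2) G.

Definition served_count G k := count (fun g => g.2 <= tick k) G.

(** Visit [k] takes place at time [tick k.+1], whence the bound on the issue step. *)
Definition stops n ps (y : nat -> V) : seq (V * nat) :=
  flatten [seq [seq p <- ps | (p.1 == y k) && (p.2 <= k.+1)%N] | k <- iota 0 n].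

Lemma in_window_exists n (d : R) :
  0 <= d -> d <= tick n -> exists2 k, (k <= n)%N & in_window k d.
Proof.
move=> d0 dn; case: (ex_minnP (ex_intro (fun k => d <= tick k) n dn)) => k dk mink.
exists k; first exact: mink.
rewrite /in_window dk andbT; case: k dk mink => [|k] dk mink.
  by rewrite /tick muln0; lra.
rewrite tickS addrK ltNge; apply/negP => /mink; by rewrite ltnn.
Qed.

Lemma in_window_leq k l (d : R) : in_window k d -> d <= tick l -> (k <= l)%N.
Proof.
case: k => // k; rewrite /in_window tickS addrK => /andP[kd _] dl.
by rewrite ltnNge -le_tick; apply/negP; lra.
Qed.

Lemma in_window_geq k m (d : R) : in_window k d -> tick m <= d -> (m <= k)%N.
Proof. by case/andP=> _ dk md; rewrite -le_tick; lra. Qed.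

Variables (n : nat) (ps : seq (V * nat)) (G : seq (V * nat * R)).
Hypothesis G_uniq : uniq (map fst G).
Hypothesis G_ps : forall g, g \in G -> g.1 \in ps.
Hypothesis G_release : forall g, g \in G -> tick g.1.2 <= g.2.
Hypothesis G_gap : forall g h, g \in G -> h \in G -> g.1.1 != h.1.1 ->
  g.2 + 2 <= h.2 \/ h.2 + 2 <= g.2.
Hypothesis psS : forall v k, ((v, k.+1) \in ps) = (k <= n)%N && visited G k v.

(** * One online service per window *)

Lemma G_inj g h : g \in G -> h \in G -> g.1 = h.1 -> g = h.
Proof. by move=> gG hG; apply: (map_uniq_inj_in G_uniq). Qed.

(* At any time at most one issued request per vertex is still unserved. *)
Lemma served_before v m m' : (v, m.+1) \in ps -> (v, m') \in ps ->
  (m' <= m)%N -> exists2 g, g \in G & g.1 = (v, m') /\ g.2 <= tick m.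
Proof.
elim/ltn_ind: m m' => m IHm m' psm psm' le_m'm.
move: (psm); rewrite psS => /andP[_ /hasP[[[w m''] d] gG /= /andP[/eqP Dw win]]].
rewrite {w}Dw in gG; have le_m''m : (m'' <= m)%N.
  exact: in_window_geq win (G_release gG).
(* The request [(v, m.+1)] answers a service of some [(v, m'')] in window [m]. If [m' < m''],
   induction on the issue of [(v, m'')] concludes; if [m'' < m'], induction on the issue of
   [(v, m')] has [(v, m'')] served before window [m], a contradiction. *)
have [lt_m'|lt_m''|eq_m] := ltngtP m' m''.
- case: m'' => // m'' in gG lt_m' le_m''m *.
  have [g gG' [g1 g2]] := IHm m'' le_m''m m' (G_ps gG) psm' lt_m'.
  exists g => //; split=> //; apply: le_trans g2 _; rewrite le_tick; lia.
- case: m' => // m' in psm' le_m'm lt_m'' *.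
  have [g gG' [g1 g2]] := IHm m' le_m'm m'' psm' (G_ps gG) lt_m''.
  have := G_inj gG' gG g1; move=> Dg; rewrite Dg /= in g2.
  by have := in_window_leq win g2; rewrite leqNgt le_m'm.
- by exists (v, m'', d) => //=; rewrite eq_m; split=> //; case/andP: win.
Qed.

(** Distinct vertices are separated by the travel time. At a single vertex, [served_before] puts the
    service of the earlier request at least one full step before the release of the later one. *)
Lemma in_window_inj k g h : g \in G -> h \in G ->
  in_window k g.2 -> in_window k h.2 -> g = h.
Proof.
move=> gG hG wg wh; have [eqv|neqv] := eqVneq g.1.1 h.1.1; last first.
  move: wg wh (G_gap gG hG neqv); rewrite /in_window => /andP[? ?] /andP[? ?].
  by case=> ?; exfalso; lra.
wlog le_gh : g h gG hG wg wh eqv / (g.1.2 <= h.1.2)%N.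
  by move=> IH; case/orP: (leq_total g.1.2 h.1.2) => ?; [|symmetry]; apply: IH.
move: le_gh; rewrite leq_eqVlt => /predU1P[eqm|].
  by apply: G_inj => //; rewrite [g.1]surjective_pairing eqv eqm -surjective_pairing.
have := G_release hG; have := G_ps hG; have := G_ps gG.
case: g h => [[v m] d] [[v' m'] d'] /= in gG hG wg wh eqv *.
subst v'; case: m' => // m' in hG * => psm psm' rel lt_mm'.
have [g0 g0G [g01 g02]] := served_before psm' psm lt_mm'.
have Dg0 := G_inj g0G gG g01; rewrite Dg0 /= in g02.
by have := leq_trans (in_window_geq wh rel) (in_window_leq wg g02); rewrite ltnn.
Qed.

Lemma count_in_window k : (count (fun g => in_window k g.2) G <= 1)%N.
Proof.
rewrite -size_filter; set l := filter _ _.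
have ul : uniq l by rewrite filter_uniq ?(map_uniq G_uniq).
have lG g : g \in l -> g \in G /\ in_window k g.2.
  by rewrite mem_filter => /andP[].
case: l ul lG => [|g [|h l]] //= /andP[/negP gN _] lG; case: gN.
have [gG wg] := lG g (mem_head _ _).
have [hG wh] : h \in G /\ in_window k h.2 by apply: lG; rewrite !inE eqxx orbT.
by rewrite (in_window_inj gG hG wg wh) mem_head.
Qed.

Lemma served_count0 : (served_count G 0 <= 1)%N.
Proof.
apply: leq_trans (count_in_window 0); rewrite eq_leq //.
apply: eq_in_count => g gG; apply/esym; rewrite /in_window andb_idl // => _.
by have := G_release gG; have := ler0n R (2 * g.1.2); rewrite /tick; lra.
Qed.

Lemma served_countS k : (served_count G k.+1 <= (served_count G k).+1)%N.
Proof.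
rewrite -[leqRHS]addn1; apply: leq_trans (leq_add (leqnn _) (count_in_window k.+1)).
rewrite -count_predUI; apply: leq_trans (leq_addr _ _).
apply: sub_count => g /= dk; rewrite /in_window dk tickS addrK andbT.
by case: leP.
Qed.

Lemma served_countD k j : (served_count G (k + j) <= served_count G k + j)%N.
Proof.
elim: j => [|j IHj]; rewrite ?addn0 // !addnS.
exact: leq_trans (served_countS _) _.
Qed.

Lemma served_count_le k : (served_count G k <= k.+1)%N.
Proof. by have := served_countD 0 k; have := served_count0; rewrite add0n; lia. Qed.

(** * Choice of the offline stops *)

Hypothesis V_large : (n.+1 + n.+1 <= #|V|)%N.

Let unserved := [set v | all (fun g => ~~ ((g.1.1 == v) && (g.2 <= tick n))) G].

(** One service per window leaves at most [n.+1] vertices served up to [tick n], which is at most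
    half of them. *)
Lemma card_unserved : (n.+1 <= #|unserved|)%N.
Proof.
have : (#|~: unserved| <= n.+1)%N.
  apply: leq_trans (served_count_le n).
  rewrite /served_count -size_filter -(size_map (fun g => g.1.1)).
  apply: leq_trans (card_size _); apply: subset_leq_card; apply/subsetP => v.
  rewrite !inE -has_predC => /hasP[g gG /=]; rewrite negbK => /andP[/eqP <- dn].
  by apply/mapP; exists g => //; rewrite mem_filter dn.
by have := cardsC unserved; lia.
Qed.

Let final_visit k v := visited G k v &&
  [forall k' : 'I_n.+1, (k < k')%N ==> ~~ visited G k' v].

Variable v0 : V.

(* Going to [v] only after the online server's final service there yields all
   that it ever took at [v], plus the request issued in return for that final
   service. *)
Let next_stop k :=
  if [pick v | final_visit k v] is Some v then v else nth v0 (enum unserved) k.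

Lemma visited_inj k v w : visited G k v -> visited G k w -> v = w.
Proof.
move=> /hasP[g gG /andP[/eqP <- wg]] /hasP[h hG /andP[/eqP <- wh]].
by rewrite (in_window_inj gG hG wg wh).
Qed.

Lemma next_stop_final k v : final_visit k v -> next_stop k = v.
Proof.
move=> fv; rewrite /next_stop; case: pickP => [w|/(_ v)]; last by rewrite fv.
by case/andP=> kw _; case/andP: fv => kv _; apply: visited_inj kw kv.
Qed.

Lemma visited_unserved k v : (k <= n)%N -> visited G k v -> v \notin unserved.
Proof.
move=> le_kn /hasP[g gG /andP[gv /andP[_ wg]]]; rewrite inE -has_predC.
apply/hasP; exists g => //=; rewrite negbK gv (le_trans wg) //.
by rewrite le_tick.
Qed.

Lemma next_stop_spec k : (k <= n)%N ->
  final_visit k (next_stop k) \/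
  next_stop k \in unserved /\ next_stop k = nth v0 (enum unserved) k.
Proof.
move=> le_kn; rewrite /next_stop; case: pickP => [v fv|_]; [by left | right].
split=> //; rewrite -mem_enum mem_nth // -cardE.
exact: leq_trans card_unserved.
Qed.

(** A vertex has only one final window, the fallback vertices are distinct entries of an
    enumeration, and a visited vertex is never unserved. *)
Lemma next_stop_inj k l : (k <= n)%N -> (l <= n)%N ->
  next_stop k = next_stop l -> k = l.
Proof.
wlog le_kl : k l / (k <= l)%N => [IH kn ln eqkl|].
  by case/orP: (leq_total k l) => ?; [|symmetry]; apply: IH.
move=> kn ln eqkl; move: le_kl; rewrite leq_eqVlt => /predU1P[//|lt_kl].
have [/andP[vk /forallP fk]|[uk Dk]] := next_stop_spec kn;
have [/andP[vl _]|[ul Dl]] := next_stop_spec ln.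
- have := fk (Ordinal (ln : (l < n.+1)%N)); rewrite lt_kl /= eqkl.
  by rewrite vl.
- by have := visited_unserved kn vk; rewrite eqkl ul.
- by have := visited_unserved ln vl; rewrite -eqkl uk.
- apply/eqP; rewrite -(nth_uniq v0 _ _ (enum_uniq (mem unserved))) -?cardE.
  + by rewrite -Dk -Dl eqkl.
  + exact: leq_trans card_unserved.
  + exact: leq_trans card_unserved.
Qed.

Lemma mem_stops y p : reflect
  (exists k, [/\ (k <= n)%N, p \in ps, p.1 = y k & (p.2 <= k.+1)%N])
  (p \in stops n.+1 ps y).
Proof.
apply: (iffP flatten_mapP) => [[k]|[k [kn pps py pk]]].
  rewrite mem_iota mem_filter => kn /andP[/andP[/eqP py pk] pps].
  by exists k.
exists k; first by rewrite mem_iota.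
by rewrite mem_filter py eqxx pk pps.
Qed.

Hypothesis ps_uniq : uniq ps.

Lemma stops_uniq y : {in [pred k | (k <= n)%N] &, injective y} ->
  uniq (stops n.+1 ps y).
Proof.
move=> y_inj; rewrite /stops.
have : {subset iota 0 n.+1 <= [pred k | (k <= n)%N]}.
  by move=> k; rewrite mem_iota.
have := iota_uniq 0 n.+1; elim: (iota 0 n.+1) => //= k l IHl /andP[kl ul] sub.
rewrite cat_uniq filter_uniq //= IHl // ?andbT; last first.
  by move=> j jl; apply: sub; rewrite inE jl orbT.
apply/hasPn => p /flatten_mapP[j jl].
rewrite !mem_filter => /andP[/andP[/eqP -> _] _].
apply/negP => /andP[/andP[/eqP/y_inj Djk _] _]; move: kl.
by rewrite -Djk ?jl //; apply: sub; rewrite inE ?eqxx ?jl ?orbT.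
Qed.

(** The stop at a vertex comes after the last online visit there up to [tick n], hence after the
    release of every request served there by then. *)
Lemma served_mem_stops g : g \in G -> g.2 <= tick n ->
  g.1 \in stops n.+1 ps next_stop.
Proof.
move=> gG gn; set v := g.1.1.
have g0 : 0 <= g.2.
  by have := G_release gG; have := ler0n R (2 * g.1.2); rewrite /tick; lra.
have [k0 k0n wg] := in_window_exists g0 gn.
have vk0 : visited G k0 v by apply/hasP; exists g => //; rewrite /v eqxx.
pose P k := (k <= n)%N && visited G k v.
have exP : exists k, P k by exists k0; rewrite /P k0n.
have ubP k : P k -> (k <= n)%N by case/andP.
case: (ex_maxnP exP ubP) => k /andP[kn vk] maxk.
have fv : final_visit k v.
  rewrite /final_visit vk; apply/forallP => j; apply/implyP => lt_kj.
  apply/negP => vj; have := maxk j; rewrite /P -ltnS ltn_ord vj => /(_ isT).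
  by rewrite leqNgt lt_kj.
apply/mem_stops; exists k; split=> //; first exact: G_ps.
  by rewrite (next_stop_final fv).
have := in_window_geq wg (G_release gG).
by have := maxk k0; rewrite /P k0n vk0 => /(_ isT); lia.
Qed.

Hypothesis ps0 : forall v, (v, 0%N) \in ps.

(** After a final visit in window [k], the witness is the answering request [(v, k.+1)]: serving it
    by [tick n] would be a later visit. At an unserved vertex it is the initial request. *)
Lemma extra_stop k : (k <= n)%N -> exists p,
  [/\ p \in ps, p.1 = next_stop k, (p.2 <= k.+1)%N &
      forall g, g \in G -> g.2 <= tick n -> g.1 != p].
Proof.
move=> kn; have [/andP[vk /forallP fk]|[uk _]] := next_stop_spec kn.
  exists (next_stop k, k.+1); rewrite psS kn vk /=; split=> // g gG gn.
  apply/eqP => Dg; have := G_release gG; rewrite Dg /= => rel.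
  have g0 : 0 <= g.2 by have := ler0n R (2 * k.+1); rewrite /tick in rel; lra.
  have [j jn wg] := in_window_exists g0 gn.
  have := fk (Ordinal (jn : (j < n.+1)%N)).
  rewrite /= (in_window_geq wg rel) /= => /hasPn/(_ g gG).
  by rewrite Dg /= eqxx wg.
exists (next_stop k, 0%N); split=> //= g gG gn; apply/eqP => Dg.
by move: uk; rewrite inE => /allP/(_ g gG); rewrite Dg /= eqxx gn.
Qed.

(** The requests served online by [tick n], together with one extra request per stop, are pairwise
    distinct and all collected. *)
Lemma stops_exist : exists2 y, uniq (stops n.+1 ps y) &
  (served_count G n + n.+1 <= size (stops n.+1 ps y))%N.
Proof.
exists next_stop; first by apply: stops_uniq => k l; apply: next_stop_inj.
pose A := [seq g.1 | g <- G & g.2 <= tick n].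
(* The default of [head] is never returned for [k <= n], since [extra_stop] makes the list
   nonempty. *)
pose e k := head (v0, 0%N)
  [seq p <- ps | [&& p.1 == next_stop k, (p.2 <= k.+1)%N & p \notin A]].
have eP k : (k <= n)%N -> [/\ e k \in ps, (e k).1 = next_stop k,
    ((e k).2 <= k.+1)%N & e k \notin A].
  move=> kn; have [p [pps pk pk1 pA]] := extra_stop kn.
  have : e k \in [seq p <- ps | [&& p.1 == next_stop k, (p.2 <= k.+1)%N & p \notin A]].
    rewrite /e; case Dl: filter => [|q l] /=; last exact: mem_head.
    suff : p \in ([::] : seq (V * nat)) by [].
    rewrite -Dl mem_filter pk eqxx pk1 pps andbT /=.
    apply/mapP => -[g]; rewrite mem_filter => /andP[gn gG] Dp.
    by have := pA g gG gn; rewrite Dp eqxx.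
  by rewrite mem_filter => /andP[/and3P[/eqP]].
have -> : (served_count G n + n.+1)%N = size (A ++ [seq e k | k <- iota 0 n.+1]).
  by rewrite size_cat !size_map size_filter size_iota.
apply: uniq_leq_size => [|p].
  rewrite cat_uniq; apply/and3P; split.
  - have sub : subseq A (map fst G) by apply/map_subseq/filter_subseq.
    exact: subseq_uniq sub G_uniq.
  - apply/hasPn => _ /mapP[k + ->]; rewrite mem_iota => kn.
    by have [] := eP k kn.
  - rewrite map_inj_in_uniq ?iota_uniq // => k l; rewrite !mem_iota => kn ln Dkl.
    have [_ ek _ _] := eP k kn; have [_ el _ _] := eP l ln.
    by apply: next_stop_inj => //; rewrite -ek Dkl.
rewrite mem_cat => /orP[/mapP[g + ->]|/mapP[k + ->]].
  by rewrite mem_filter => /andP[gn gG]; apply: served_mem_stops.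
rewrite mem_iota => kn; have [? ? ? _] := eP k kn.
by apply/mem_stops; exists k; split.
Qed.

End Tour.

(** * The adversary *)

Section Adversary.
Variables (R : realType) (n : nat).
Local Notation V := ('I_(n + n.+1).+1).

Definition discrete_weight (u v : V) : R := if u == v then 0 else 2.

Lemma discrete_weight_id u : discrete_weight u u = 0.
Proof. by rewrite /discrete_weight eqxx. Qed.

Lemma discrete_weight_sym u v : discrete_weight u v = discrete_weight v u.
Proof. by rewrite /discrete_weight eq_sym. Qed.

Lemma discrete_weight_bound u v : u != v ->
  0 < discrete_weight u v <= tick R n.+3 / n.+3%:R.
Proof.
move=> /negbTE neq_uv; rewrite /discrete_weight neq_uv /tick natrM.
by rewrite mulfK ?pnatr_eq0 // lexx andbT ltr0n.
Qed.

Lemma discrete_tlimit_gt0 : 0 < tick R n.+3.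
Proof. by rewrite /tick ltr0n. Qed.

Lemma discrete_fpar_bound : (1 : R) < n.+3%:R < tick R n.+3.
Proof. by rewrite /tick ltr1n ltr_nat; lia. Qed.

(** Here [T = 2(n+3)] and [f = n+3], so [T/f] is the travel time 2 and [T - 2T/f] is [tick n.+1],
    the time of the last of [n.+1] offline visits. The [2n+2] vertices are what [card_unserved]
    requires. *)
Definition discrete_network : network R :=
  Network ord0 discrete_weight_id discrete_weight_sym discrete_weight_bound
    discrete_tlimit_gt0 discrete_fpar_bound.

Lemma discrete_deadline : tlimit discrete_network -
  2 * tlimit discrete_network / fpar discrete_network = tick R n.+1.
Proof.
by rewrite /= -mulrA /tick natrM mulfK ?pnatr_eq0 // -!natrM -natrB; [|lia];
  congr (_%:R); lia.
Qed.

Lemma discrete_triangle (u v w : discrete_network) :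
  weight u w <= weight u v + weight v w.
Proof.
rewrite /= /discrete_weight; have [->|neq_uv] := eqVneq u v; first by rewrite add0r.
by case: ifP => _; case: ifP => _; lra.
Qed.

(* Serving a request whose source and destination coincide takes no time. *)
Definition point_request (p : V * nat) : request discrete_network :=
  @Request R discrete_network p.1 p.1 (tick R p.2) 1.

Definition trace (ps : seq (V * nat)) (s : schedule discrete_network) :
    seq (V * nat * R) :=
  [seq (nth (ord0, 0%N) ps q.1, q.2) | q <- services s].

Lemma onth_point_request ps i : (i < size ps)%N ->
  onth (map point_request ps) i = Some (point_request (nth (ord0, 0%N) ps i)).
Proof.
move=> lti; rewrite onthE (nth_map (point_request (ord0, 0%N))) ?size_map //.
by rewrite (nth_map (ord0, 0%N)).
Qed.

Lemma onth_point_request_index ps p : p \in ps ->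
  onth (map point_request ps) (index p ps) = Some (point_request p).
Proof. by move=> pps; rewrite onth_point_request ?index_mem // nth_index. Qed.

(** * The offline tour as a schedule *)

Section OfflineTour.
Variables (ps : seq (V * nat)) (y : nat -> V).
Let rs := map point_request ps.

(** Having left at [tick k], the server is at [y k] by [tick k.+1], whether or not it had to move,
    and serves all its requests there at that one instant. *)
Let tour_leg k : schedule discrete_network :=
  @Step R discrete_network (tick R k) (@Travel R discrete_network (y k)) ::
  [seq @Step R discrete_network (tick R k.+1) (Serve (index p ps))
     | p <- ps & (p.1 == y k) && (p.2 <= k.+1)%N].

Definition tour m := flatten [seq tour_leg k | k <- iota 0 m].

Lemma tour_executable m : executable rs (origin discrete_network) 0 (tour m).
Proof.
have : 0 <= tick R 0 by rewrite /tick.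
rewrite /tour; move: (origin _) (0 : R) 0%N.
elim: m => //= m IHm x t k le_tk; split=> //.
rewrite (map_comp (fun i => Step _ (Serve i)) (index^~ ps)).
apply: executable_serve_all; last exact: IHm.
  by rewrite tickS /discrete_weight; case: ifP => _; lra.
move=> _ /mapP[p + ->]; rewrite mem_filter => /andP[/andP[/eqP py pk] pps].
exists (point_request p); rewrite onth_point_request_index //; split=> //=.
by rewrite le_tick.
Qed.

Lemma services_tour m : services (tour m) =
  flatten [seq [seq (index p ps, tick R k.+1)
     | p <- ps & (p.1 == y k) && (p.2 <= k.+1)%N] | k <- iota 0 m].
Proof.
rewrite /tour; elim: (iota 0 m) => //= k l IHl; rewrite -IHl services_cat.
by congr (_ ++ _); elim: filter => //= p l' ->.
Qed.

Lemma served_tour m : served (tour m) = map (index^~ ps) (stops m ps y).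
Proof.
rewrite served_services services_tour /stops !map_flatten -!map_comp.
by congr flatten; apply: eq_map => k /=; rewrite -map_comp.
Qed.

Lemma tour_feasible m : uniq (stops m ps y) -> feasible rs (tour m).
Proof.
move=> us; split; first exact: tour_executable.
rewrite served_tour map_inj_in_uniq // => p q /flatten_mapP[k _].
rewrite mem_filter => /andP[_ pps] /flatten_mapP[l _].
rewrite mem_filter => /andP[_ qps] eq_idx.
by rewrite -(nth_index p pps) eq_idx nth_index.
Qed.

Lemma earned_by_tour m : earned_by rs (tick R m) (tour m) = (size (stops m ps y))%:R.
Proof.
rewrite -(size_map (index^~ ps)) -served_tour served_services size_map.
rewrite earned_by_services -sum1_size natr_sum; apply: eq_big_seq => q.
rewrite services_tour => /flatten_mapP[k]; rewrite mem_iota => km /mapP[p].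
rewrite mem_filter => /andP[_ pps] -> /=.
rewrite onth_point_request_index //= discrete_weight_id addr0 le_tick.
by case/andP: km => _; rewrite add0n => ->.
Qed.

End OfflineTour.

(** * The adaptive request sequence *)

Variable sol : seq (request discrete_network) -> schedule discrete_network.
Hypothesis sol_feasible : forall rs, uniform_roldarp rs -> feasible rs (sol rs).
Hypothesis sol_online : forall rs rs' t, uniform_roldarp rs -> uniform_roldarp rs' ->
  released_by t rs = released_by t rs' ->
  started_by t (sol rs) = started_by t (sol rs').

Let strace ps := trace ps (sol (map point_request ps)).

(** Each step runs [sol] on the requests issued so far and looks only at services up to the current
    tick; the rest of that run is discarded. *)
Fixpoint issued k : seq (V * nat) :=
  if k is k'.+1 then
    issued k' ++ [seq (v, k) | v <- enum V & visited (strace (issued k')) k' v]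
  else [seq (v, 0%N) | v <- enum V].

Lemma issued_time k p : p \in issued k -> (p.2 <= k)%N.
Proof.
elim: k => [|k IHk] /=; first by case/mapP=> v _ ->.
by rewrite mem_cat => /orP[/IHk/leqW//|/mapP[v _ ->]].
Qed.

Lemma issued_uniq k : uniq (issued k).
Proof.
have inj (j : nat) : injective (fun v : V => (v, j)) by move=> u v [].
elim: k => [|k IHk] /=; first by rewrite (map_inj_uniq (inj _)) enum_uniq.
rewrite cat_uniq IHk (map_inj_uniq (inj _)) filter_uniq ?enum_uniq // andbT /=.
apply/hasPn => _ /mapP[v _ ->]; apply/negP => /issued_time.
by rewrite ltnn.
Qed.

Lemma issued_cat k j : exists2 l, issued (k + j) = issued k ++ l &
  all (fun p => (k < p.2)%N) l.
Proof.
elim: j => [|j [l Dl kl]]; first by exists [::]; rewrite ?(addn0 k) ?cats0.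
rewrite (addnS k) /= Dl -catA; eexists; first by [].
by rewrite all_cat kl /=; apply/allP => _ /mapP[v _ ->] /=; rewrite ltnS leq_addr.
Qed.

Lemma issued_valid k : uniform_roldarp (map point_request (issued k)).
Proof.
split; last by exists 1; rewrite all_map; apply/allP => p _ /=; rewrite eqxx.
apply/andP; split; last first.
  by rewrite all_map; apply/allP => p _ /=; rewrite /tick ler0n ltr01.
rewrite sorted_pairwise; last by move=> r1 r2 r3 /=; apply: le_trans.
rewrite pairwise_map; elim: k => [|k IHk] /=.
  rewrite pairwise_map; apply/(pairwiseP ord0) => i j _ _ _ /=.
  exact: lexx.
rewrite pairwise_cat IHk /=; apply/andP; split.
  apply/allrelP => p _ /issued_time pk /mapP[v _ ->] /=.
  by rewrite le_tick leqW.
by rewrite pairwise_map; apply/(pairwiseP ord0) => i j _ _ _ /=; apply: lexx.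
Qed.

Lemma released_issued k j :
  released_by (tick R k) (map point_request (issued (k + j))) =
  map point_request (issued k).
Proof.
have [l -> kl] := issued_cat k j.
rewrite map_cat /released_by filter_cat !filter_map.
rewrite (eq_in_filter (a2 := predT)) => [|p /issued_time /=]; last first.
  by rewrite le_tick => ->.
rewrite filter_predT (eq_in_filter (a2 := pred0)) => [|p /(allP kl) /=].
  by rewrite filter_pred0 cats0.
by rewrite le_tick ltnNge => /negbTE.
Qed.

Lemma services_issued k q : q \in services (sol (map point_request (issued k))) ->
  [/\ (q.1 < size (issued k))%N,
      onth (map point_request (issued k)) q.1 =
        Some (point_request (nth (ord0, 0%N) (issued k) q.1)) &
      tick R (nth (ord0, 0%N) (issued k) q.1).2 <= q.2].
Proof.
case: q => i d sq; have [exs _] := sol_feasible (issued_valid k).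
have [r Dr rd] := services_released exs sq.
have lti : (i < size (issued k))%N.
  by rewrite -(size_map point_request) -onthTE Dr.
split=> //=; first exact: onth_point_request.
by move: Dr rd; rewrite onth_point_request // => -[<-].
Qed.

(** Both sequences release the same requests by [tick k], so the online condition gives the same
    services; their indices denote the same requests because one sequence extends the other. *)
Lemma strace_issued k j :
  [seq g <- strace (issued (k + j)) | g.2 <= tick R k] =
  [seq g <- strace (issued k) | g.2 <= tick R k].
Proof.
rewrite /strace /trace !filter_map.
have -> : [seq q <- services (sol (map point_request (issued (k + j)))) |
    q.2 <= tick R k] =
  [seq q <- services (sol (map point_request (issued k))) | q.2 <= tick R k].
  rewrite -!services_started; congr services; apply: sol_online.
  - exact: issued_valid.
  - exact: issued_valid.
  by have := released_issued k 0; rewrite (addn0 k) released_issued => ->.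
apply/eq_in_map => q; rewrite mem_filter => /andP[_ /services_issued[ltq _ _]].
by have [l -> _] := issued_cat k j; rewrite nth_cat ltq.
Qed.

Lemma visited_issued k j v :
  visited (strace (issued (k + j))) k v = visited (strace (issued k)) k v.
Proof.
have vE G : visited G k v = visited [seq g <- G | g.2 <= tick R k] k v.
  rewrite /visited [RHS]has_filter -filter_predI -has_filter; apply: eq_has => g /=.
  by rewrite /in_window; case: (g.2 <= _); rewrite ?andbF ?andbT.
by rewrite vE strace_issued -vE.
Qed.

Lemma mem_issued0 k v : (v, 0%N) \in issued k.
Proof.
have [l] := issued_cat 0 k; rewrite add0n => -> _.
by rewrite mem_cat map_f ?mem_enum.
Qed.

(** The adversary reacts to the run on [issued m]; [visited_issued] transfers the visit to the run
    on the longer sequence, as the hypothesis [psS] of the tour requires. *)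
Lemma mem_issuedS k m v : ((v, m.+1) \in issued k) =
  (m < k)%N && visited (strace (issued k)) m v.
Proof.
have [lt_mk|le_km] /= := ltnP m k; last first.
  by apply/negP => /issued_time /=; rewrite ltnNge le_km.
rewrite -(subnKC lt_mk) [in RHS](addSnnS m) visited_issued.
have [l -> /allP ml] := issued_cat m.+1 (k - m.+1); rewrite mem_cat /=.
have /negbTE-> : (v, m.+1) \notin l by apply/negP => /ml; rewrite ltnn.
rewrite orbF mem_cat; have /negbTE-> /= : (v, m.+1) \notin issued m.
  by apply/negP => /issued_time; rewrite ltnn.
apply/mapP/idP => [[w + [->]]|vv]; first by rewrite mem_filter => /andP[].
by exists v => //; rewrite mem_filter vv mem_enum.
Qed.

(** * Comparison of revenues *)

Let ps := issued n.+1.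
Let rs := map point_request ps.
Let G := strace ps.

Lemma strace_uniq : uniq (map fst G).
Proof.
rewrite /G /strace /trace -map_comp.
have [_ ] := sol_feasible (issued_valid n.+1); rewrite served_services => us.
rewrite (eq_map (g := (nth (ord0, 0%N) ps) \o fst)) // map_comp.
rewrite map_inj_in_uniq // => i j /mapP[q /services_issued[lti _ _] ->].
move=> /mapP[q' /services_issued[ltj _ _] ->] /eqP.
by rewrite nth_uniq ?issued_uniq // => /eqP.
Qed.

Lemma strace_ps g : g \in G -> g.1 \in ps.
Proof. by case/mapP=> q /services_issued[lti _ _] ->; apply: mem_nth. Qed.

Lemma strace_release g : g \in G -> tick R g.1.2 <= g.2.
Proof. by case/mapP=> q /services_issued[_ _ rel] ->. Qed.

Lemma strace_gap g h : g \in G -> h \in G -> g.1.1 != h.1.1 ->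
  g.2 + 2 <= h.2 \/ h.2 + 2 <= g.2.
Proof.
case/mapP=> -[i d] sq -> /mapP[[j e] sq' ->] /= neq.
have [_ Di _] := services_issued sq; have [_ Dj _] := services_issued sq'.
have [exs _] := sol_feasible (issued_valid n.+1).
have neq_ij : i != j by apply: contraNneq neq => ->.
have := services_gap discrete_triangle exs sq sq' neq_ij Di Dj.
by rewrite /= /discrete_weight (negbTE neq) eq_sym (negbTE neq).
Qed.

Lemma earned_by_online :
  earned_by rs (tick R n.+3) (sol rs) <= (served_count G n.+3)%:R.
Proof.
rewrite earned_by_services /served_count /G /strace /trace count_map.
rewrite -sum1_count natr_sum [leRHS]big_mkcond /= big_seq [leRHS]big_seq.
apply: ler_sum => q /services_issued[_ -> _] /=.
by rewrite discrete_weight_id addr0; case: ifP.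
Qed.

(** Here [c] counts the online services up to [tick n]. The offline tour gains one extra request at
    each of [n.+1] stops, while the three windows left until [T] bring the online server at most 3
    more. *)
Lemma adversary_wins : exists opt (c : nat),
  [/\ (c <= n.+1)%N, is_max_revenue_by rs (tick R n.+1) opt,
      (c + n.+1)%:R <= opt &
      earned_by rs (tick R n.+3) (sol rs) <= c.+3%:R].
Proof.
have Vlarge : (n.+1 + n.+1 <= #|{: V}|)%N by rewrite card_ord.
have psS v k : ((v, k.+1) \in ps) = (k <= n)%N && visited G k v.
  exact: mem_issuedS.
have [y uy ley] := stops_exist strace_uniq strace_ps strace_release strace_gap
  psS Vlarge ord0 (issued_uniq n.+1) (mem_issued0 n.+1).
have rev1 : all (fun r => revenue r == 1) rs.
  by rewrite all_map; apply/allP => p _ /=; rewrite eqxx.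
have [opt maxo leo] := max_revenue_exists (tick R n.+1) rev1 (tour_feasible uy).
exists opt, (served_count G n); split=> //.
- exact: (served_count_le strace_uniq strace_ps strace_release strace_gap psS).
- by apply: le_trans leo; rewrite earned_by_tour ler_nat.
- apply: le_trans earned_by_online _; rewrite ler_nat.
  have := served_countD strace_uniq strace_ps strace_release strace_gap psS n 3.
  by rewrite !addn3.
Qed.

End Adversary.

(** * The bound for every ratio below 2 *)

Lemma uniform_lower_bound (R : realType) (beta : R) (hbeta : beta < 2)
    (alg : forall N : network R, seq (request N) -> schedule N) :
  online_algorithm (@uniform_roldarp R) alg ->
  exists (N : network R) (rs : seq (request N)) (opt : R),
    [/\ uniform_roldarp rs,
        is_max_revenue_by rs (tlimit N - 2 * tlimit N / fpar N) opt &
        opt > beta * earned_by rs (tlimit N) (alg N rs)].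
Proof.
case=> alg_feasible alg_online.
(* For [1 < beta], [c <= n+1] gives [beta * (c+3) <= c + (beta-1)(n+1) + 3 * beta], which is below
   [c+n+1] once [(2-beta)(n+1) > 6]. For [beta <= 1], it suffices that [n+1 > 3], whence the summand
   3. *)
pose n := (Num.bound (6 / (2 - beta)) + 3)%N.
have [gt_n ge3n] : 6 < (2 - beta) * n.+1%:R /\ 4 <= n.+1%:R :> R.
  split; last by rewrite ler_nat /n; lia.
  have b2 : 0 < 2 - beta by lra.
  have x0 : 0 <= 6 / (2 - beta) by rewrite divr_ge0 // ltW.
  rewrite mulrC -ltr_pdivrMr //; apply: lt_le_trans (archi_boundP x0) _.
  by rewrite ler_nat /n; lia.
have [opt [c [le_c maxo le_opt le_alg]]] :=
  adversary_wins (@alg_feasible (discrete_network R n))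
    (@alg_online (discrete_network R n)).
have valid := issued_valid (alg (discrete_network R n)) n.+1.
exists (discrete_network R n).
exists (map (point_request R (n := n)) (issued (alg (discrete_network R n)) n.+1)).
exists opt; split; first exact: valid.
  by rewrite discrete_deadline.
have [/andP[_ rs_pos] _] := valid.
apply: lt_le_trans le_opt; move: le_alg => /=.
set a := earned_by _ _ _ => le_a.
have a0 : 0 <= a.
  by apply: earned_by_ge0; apply: sub_all rs_pos => r /andP[].
move: le_c; rewrite -(ler_nat R) => le_c.
rewrite natrD; rewrite -addn3 natrD in le_a.
have [le_b1|lt_1b] := lerP beta 1; first by nra.
by nra.
Qed.

Theorem theorem1 (R : realType) (beta : R) (hbeta : beta < 2) :
  (forall alg : (forall N : network R, seq (request N) -> schedule N),
     online_algorithm (@roldarp R) alg ->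
     exists (N : network R) (rs : seq (request N)) (opt : R),
       [/\ roldarp rs,
           is_max_revenue_by rs (tlimit N - 2 * tlimit N / fpar N) opt &
           opt > beta * earned_by rs (tlimit N) (alg N rs)]) /\
  (forall alg : (forall N : network R, seq (request N) -> schedule N),
     online_algorithm (@uniform_roldarp R) alg ->
     exists (N : network R) (rs : seq (request N)) (opt : R),
       [/\ uniform_roldarp rs,
           is_max_revenue_by rs (tlimit N - 2 * tlimit N / fpar N) opt &
           opt > beta * earned_by rs (tlimit N) (alg N rs)]).
Proof.
split=> alg [alg_feasible alg_online]; last exact: uniform_lower_bound.
(* An online algorithm for arbitrary revenues is also one for uniform revenues, so the same instance
   defeats it. *)
have uniform_alg : online_algorithm (@uniform_roldarp R) alg.
  split=> [N rs [rsP _]|N rs rs' t [rsP _] [rsP' _]]; first exact: alg_feasible.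
  exact: alg_online.
have [N [rs [opt [[rsP _] maxo lto]]]] := uniform_lower_bound hbeta uniform_alg.
by exists N, rs, opt.
Qed.
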